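(* Let $X$ be a path-connected space with basepoint $x_0$ and let $G=\pi_1(X,x_0)$. Let $\Delta:\mathbf{DCov}(X)\to\Delta\mathbf{Cov}(X)$ be the functor taking a disk-covering $p:E\to X$ to the $\Delta$-covering $p:\Delta(E)\to X$ (and which is the identity on underlying functions of morphisms). Then the monodromy functors $\mu:\mathbf{DCov}(X)\to G\mathbf{Set}$ and $\mu:\Delta\mathbf{Cov}(X)\to G\mathbf{Set}$, the latter of which is fully faithful, satisfy: the functor $\mu\circ\Delta:\mathbf{DCov}(X)\to G\mathbf{Set}$ is naturally isomorphic to $\mu:\mathbf{DCov}(X)\to G\mathbf{Set}$.
   Context: Maps are continuous functions. $D^2$ is the closed unit disk with basepoint $d=(1,0)$. A map $p:E\to X$ is a disk-covering if $E$ is non-empty and path-connected and for every $e\in E$ and map $f:(D^2,d)\to(X,p(e))$ there is a unique map $\hat{f}:(D^2,d)\to(E,e)$ with $p\circ\hat{f}=f$. $\mathbf{DCov}(X)$ is the category of disk-coverings over $X$; a morphism from $p:E\to X$ to $q:E'\to X$ is a map $f:E\to E'$ with $q\circ f=p$. A subset $U\subseteq E$ is $\Delta$-open if $f^{-1}(U)$ is open in $D^2$ for every map $f:D^2\to E$; $E$ is $\Delta$-generated if its open sets are exactly its $\Delta$-open sets; $\Delta(E)$ is the set $E$ with the topology of $\Delta$-open subsets of $E$. $\Delta\mathbf{Top}_0$ is the category of path-connected $\Delta$-generated spaces. A $\Delta$-covering is a map $p:\widetilde{X}\to X$ with $\widetilde{X}\in\Delta\mathbf{Top}_0$ such that for every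 $Y\in\Delta\mathbf{Top}_0$, $\tilde{x}\in\widetilde{X}$, $y\in Y$ and map $f:(Y,y)\to(X,p(\tilde{x}))$ with $f_*(\pi_1(Y,y))\subseteq p_*(\pi_1(\widetilde{X},\tilde{x}))$, there is a unique map $\tilde{f}:(Y,y)\to(\widetilde{X},\tilde{x})$ with $p\circ\tilde{f}=f$. $\Delta\mathbf{Cov}(X)$ is the full subcategory of $\mathbf{DCov}(X)$ on the $\Delta$-coverings. A disk-covering has unique lifting of paths and of homotopies of paths. The functor $\mu$ sends $p$ to the fiber $p^{-1}(x_0)$ with the monodromy action of $G$ given by endpoints of lifts of loops (as a left action: $[\alpha]\cdot e$ is the endpoint of the lift starting at $e$ of the reverse loop $\alpha^-$), and sends a morphism to its restriction to fibers over $x_0$. $G\mathbf{Set}$ is the category of $G$-sets and $G$-equivariant functions. *)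

(* Defs.v *)
From HB Require Import structures.
From mathcomp Require Import all_boot all_order all_algebra generic_quotient.
From mathcomp Require Import all_classical reals topology normedtype homotopy.
From mathcomp Require Import ring lra.

Set Implicit Arguments.
Unset Strict Implicit.
Unset Printing Implicit Defensive.

Import Order.TTheory GRing.Theory Num.Theory.
Import numFieldNormedType.Exports.

Local Open Scope classical_set_scope.
Local Open Scope ring_scope.
Local Open Scope quotient_scope.

Lemma continuous_compT (T U V : topologicalType) (f : T -> U) (g : U -> V) :
  continuous f -> continuous g -> continuous (g \o f).
Proof. by move=> cf cg x; exact: (continuous_comp (cf x) (cg _)). Qed.

Lemma continuous_pairT (T U V : topologicalType) (f : T -> U) (g : T -> V) :
  continuous f -> continuous g -> continuous (fun x => (f x, g x)).
Proof. by move=> cf cg x; exact: (cvg_pair (cf x) (cg x)). Qed.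

Lemma continuous_idT (T : topologicalType) : continuous (fun x : T => x).
Proof. by move=> x; exact: cvg_id. Qed.

Lemma continuous_constT (T U : topologicalType) (c : U) :
  continuous (fun _ : T => c).
Proof. by move=> x; apply: cvg_cst; exact: nbhs_filter. Qed.

Lemma continuous_fstT (T U : topologicalType) : continuous (@fst T U).
Proof. by move=> x; exact: cvg_fst. Qed.

Lemma continuous_sndT (T U : topologicalType) : continuous (@snd T U).
Proof. by move=> x; exact: cvg_snd. Qed.

Lemma continuous_set_val (T : topologicalType) (A : set T) :
  continuous (set_val : A -> T).
Proof. exact: initial_continuous. Qed.

Lemma continuous_into (S T : topologicalType) (A : set T) (f : S -> A) :
  continuous (fun x => set_val (f x)) -> continuous f.
Proof. exact: (@continuous_comp_initial _ _ _ (set_val : A -> T)). Qed.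

Section RealContinuity.
Context {R : realType} {T : topologicalType}.
Implicit Types f g : T -> R.

Lemma continuous_addT f g :
  continuous f -> continuous g -> continuous (fun x => f x + g x).
Proof. by move=> cf cg x; apply: cvgD; [exact: cf|exact: cg]. Qed.

Lemma continuous_oppT f : continuous f -> continuous (fun x => - f x).
Proof. by move=> cf x; apply: cvgN; exact: cf. Qed.

Lemma continuous_mulT f g :
  continuous f -> continuous g -> continuous (fun x => f x * g x).
Proof. by move=> cf cg x; apply: cvgM; [exact: cf|exact: cg]. Qed.

Lemma continuous_minT f g :
  continuous f -> continuous g -> continuous (fun x => Num.min (f x) (g x)).
Proof. by move=> cf cg x; apply: continuous_min; [exact: cf|exact: cg]. Qed.

Lemma continuous_maxT f g :
  continuous f -> continuous g -> continuous (fun x => Num.max (f x) (g x)).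
Proof. by move=> cf cg x; apply: continuous_max; [exact: cf|exact: cg]. Qed.

Lemma paste_continuous (U : topologicalType) (u : T -> R) (f g : T -> U) :
  continuous u -> continuous f -> continuous g ->
  (forall x, u x = 0 -> f x = g x) ->
  continuous (fun x => if u x <= 0 then f x else g x).
Proof.
move=> cu cf cg fg; pose h x := if u x <= 0 then f x else g x; rewrite -/h.
pose A := [set x | u x <= 0]; pose B := [set x | 0 <= u x].
have cA : closed A by exact: (preimage_closed (fun x _ => cu x) (@closed_le R 0)).
have cB : closed B by exact: (preimage_closed (fun x _ => cu x) (@closed_ge R 0)).
suff : {within A `|` B, continuous h}.
  suff AB : A `|` B = setT by move=> ch; apply/continuous_subspace_setT; rewrite -AB.
  by rewrite -subTset => x _; case: (leP (u x) 0) => ?; [left|right; exact: ltW].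
apply: withinU_continuous => //.
  apply: (@subspace_eq_continuous _ _ _ f); last exact: continuous_subspaceT.
  by move=> x; rewrite inE /A /from_subspace /h /= => ->.
apply: (@subspace_eq_continuous _ _ _ g); last exact: continuous_subspaceT.
move=> x; rewrite inE /B /from_subspace /h /= => u0; case: ifP => // u0'.
by apply/esym/fg/le_anti; rewrite u0 u0'.
Qed.

End RealContinuity.

Ltac cont := lazymatch goal with
  | |- continuous (fun x => @?f x + @?g x) =>
      apply: (@continuous_addT _ _ f g); cont
  | |- continuous (fun x => - @?f x) => apply: (@continuous_oppT _ _ f); cont
  | |- continuous (fun x => @?f x * @?g x) =>
      apply: (@continuous_mulT _ _ f g); cont
  | |- continuous (fun x => Num.min (@?f x) (@?g x)) =>
      apply: (@continuous_minT _ _ f g); cont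
  | |- continuous (fun x => Num.max (@?f x) (@?g x)) =>
      apply: (@continuous_maxT _ _ f g); cont
  | |- continuous (fun x => x) => exact: continuous_idT
  | |- _ => first [assumption | exact: continuous_constT]
  end.

Definition unit_interval (R : realType) : Type := set_type (`[0, 1]%classic : set R).

HB.instance Definition _ (R : realType) :=
  Topological.copy (unit_interval R) (set_type (`[0, 1]%classic : set R)).

Section UnitInterval.
Context {R : realType}.
Local Notation I := (unit_interval R).

Definition uival (s : I) : R := set_val s.

Lemma uival_continuous : continuous uival.
Proof. exact: continuous_set_val. Qed.

Lemma uivalP (s : I) : 0 <= uival s /\ uival s <= 1.
Proof. by have := set_valP s; rewrite /= in_itv /= => /andP. Qed.

Lemma uival_inj : injective uival.
Proof. exact: val_inj. Qed.

Lemma clamp_subproof (r : R) : Num.min (Num.max r 0) 1 \in (`[0, 1]%classic : set R).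
Proof.
rewrite inE /= in_itv /= ge_min lexx orbT andbT.
by rewrite le_min le_max lexx orbT ler01.
Qed.

(* The retraction of R onto [0, 1]: paths are reparametrized by composing with
   [clamp], so that no bound has to be carried around. *)
Definition clamp (r : R) : I := exist _ (Num.min (Num.max r 0) 1) (clamp_subproof r).

Lemma clamp_continuous : continuous clamp.
Proof.
have c : continuous (fun r : R => Num.min (Num.max r 0) 1) by cont.
exact: (@continuous_into _ _ _ clamp c).
Qed.

Lemma uival_clamp r : uival (clamp r) = Num.min (Num.max r 0) 1.
Proof. by []. Qed.

Lemma clampK r : 0 <= r -> r <= 1 -> uival (clamp r) = r.
Proof. by move=> r0 r1; rewrite uival_clamp max_l // min_l. Qed.

Lemma uivalK (s : I) : clamp (uival s) = s.
Proof. by apply: uival_inj; have [? ?] := uivalP s; rewrite clampK. Qed.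

Lemma clamp_le0 r : r <= 0 -> clamp r = clamp 0.
Proof. by move=> r0; apply: uival_inj; rewrite !uival_clamp max_r // max_l. Qed.

Lemma clamp_ge1 r : 1 <= r -> clamp r = clamp 1.
Proof.
move=> r1; apply: uival_inj; rewrite !uival_clamp.
rewrite !max_l ?ler01 //; last exact: le_trans r1.
by rewrite min_r // min_r.
Qed.

Lemma ui_zero_neq_one : clamp 0 != clamp 1.
Proof.
apply/negP => /eqP /(congr1 uival).
by rewrite !clampK ?ler01 ?lexx // => /eqP; rewrite eq_sym oner_eq0.
Qed.

End UnitInterval.

HB.instance Definition _ (R : realType) :=
  isBiPointed.Build (unit_interval R) ui_zero_neq_one.

Section UnitIntervalEnds.
Context {R : realType}.
Local Notation I := (unit_interval R).

Lemma clamp0 r : r <= 0 -> clamp r = zero :> I. Proof. exact: clamp_le0. Qed.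
Lemma clamp1 r : 1 <= r -> clamp r = one :> I. Proof. exact: clamp_ge1. Qed.
Lemma uival0 : uival (zero : I) = 0. Proof. by rewrite clampK ?ler01 ?lexx. Qed.
Lemma uival1 : uival (one : I) = 1. Proof. by rewrite clampK ?ler01 ?lexx. Qed.

Definition uivalE := (uival0, uival1,
  clampK (lexx 0) (@ler01 R), clampK (@ler01 R) (lexx 1)).

End UnitIntervalEnds.

Section PathOperations.
Context {R : realType} {X : topologicalType}.
Local Notation I := (unit_interval R).
Local Notation path x y := ({path I from x to y in X}).

Section Concat.
Context (x y z : X) (a : path x y) (b : path y z).

Definition path_concat_fun (s : I) : X :=
  if 2 * uival s - 1 <= 0 then a (clamp (2 * uival s))
  else b (clamp (2 * uival s - 1)).

Lemma path_concat_continuous : continuous path_concat_fun.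
Proof.
have cu := @uival_continuous R.
apply: (paste_continuous (u := fun s => 2 * uival s - 1)
  (f := fun s => a (clamp (2 * uival s)))
  (g := fun s => b (clamp (2 * uival s - 1)))).
- cont.
- apply: (continuous_compT (f := fun s => clamp (2 * uival s)) (g := a)).
    apply: (continuous_compT (g := clamp)); [cont|exact: clamp_continuous].
  exact: cts_fun.
- apply: (continuous_compT (f := fun s => clamp (2 * uival s - 1)) (g := b)).
    apply: (continuous_compT (g := clamp)); [cont|exact: clamp_continuous].
  exact: cts_fun.
- move=> s s0; rewrite clamp1; last by lra.
  by rewrite clamp0 ?path_one ?path_zero // s0.
Qed.

Lemma path_concat_zero : path_concat_fun zero = x.
Proof.
rewrite /path_concat_fun uival0 mulr0 sub0r oppr_le0 ler01.
by rewrite clamp0 // path_zero.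
Qed.

Lemma path_concat_one : path_concat_fun one = z.
Proof.
rewrite /path_concat_fun uival1 ifF; last by apply/negP; lra.
by rewrite clamp1 ?path_one //; lra.
Qed.

Definition path_concat : path x z :=
  mk_path path_concat_continuous path_concat_zero path_concat_one.

Lemma path_concatE s : path_concat s =
  if 2 * uival s - 1 <= 0 then a (clamp (2 * uival s))
  else b (clamp (2 * uival s - 1)).
Proof. by []. Qed.

End Concat.

Section Reverse.
Context (x y : X) (a : path x y).

Definition path_reverse_fun (s : I) : X := a (clamp (1 - uival s)).

Lemma path_reverse_continuous : continuous path_reverse_fun.
Proof.
have cu := @uival_continuous R.
apply: (continuous_compT (f := fun s => clamp (1 - uival s)) (g := a)).
  apply: (continuous_compT (g := clamp)); [cont|exact: clamp_continuous].
exact: cts_fun.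
Qed.

Lemma path_reverse_zero : path_reverse_fun zero = y.
Proof. by rewrite /path_reverse_fun uival0 clamp1 ?path_one // subr0. Qed.

Lemma path_reverse_one : path_reverse_fun one = x.
Proof. by rewrite /path_reverse_fun uival1 clamp0 ?path_zero // subrr. Qed.

Definition path_reverse : path y x :=
  mk_path path_reverse_continuous path_reverse_zero path_reverse_one.

Lemma path_reverseE s : path_reverse s = a (clamp (1 - uival s)).
Proof. by []. Qed.

End Reverse.

Definition path_const (x : X) : path x x := cst x.

Lemma path_constE (x : X) s : path_const x s = x.
Proof. by []. Qed.

End PathOperations.

Section Homotopy.
Context {R : realType} {X : topologicalType}.
Local Notation I := (unit_interval R).
Local Notation path x y := ({path I from x to y in X}).

(* Homotopy relative to the endpoints. *)
Definition path_homotopic (x y : X) (a b : path x y) : Prop :=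
  exists H : continuousType (I * I)%type X,
    [/\ forall s, H (s, zero) = a s,
        forall s, H (s, one) = b s,
        forall t, H (zero, t) = x &
        forall t, H (one, t) = y].

Lemma path_homotopic_reparam (x y : X) (a b : path x y)
    (w : R -> X) (f g : R -> R) :
  continuous w -> continuous f -> continuous g ->
  (forall s : I, a s = w (f (uival s))) ->
  (forall s : I, b s = w (g (uival s))) ->
  (forall t : R, 0 <= t -> t <= 1 -> w ((1 - t) * f 0 + t * g 0) = x) ->
  (forall t : R, 0 <= t -> t <= 1 -> w ((1 - t) * f 1 + t * g 1) = y) ->
  path_homotopic a b.
Proof.
move=> cw cf cg wa wb w0 w1.
pose h (u : I * I) := w ((1 - uival u.2) * f (uival u.1)
                         + uival u.2 * g (uival u.1)).
have c1 : continuous (fun u : I * I => uival u.1).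
  exact: (continuous_compT (@continuous_fstT _ _) (@uival_continuous R)).
have c2 : continuous (fun u : I * I => uival u.2).
  exact: (continuous_compT (@continuous_sndT _ _) (@uival_continuous R)).
have ch : continuous h.
  apply: (continuous_compT (g := w)) => //.
  have ? := continuous_compT c1 cf; have ? := continuous_compT c1 cg; cont.
exists (mkcts ch); split=> r; rewrite /= /mkcts /h /= ?uivalE.
- by rewrite subr0 mul1r mul0r addr0 wa.
- by rewrite subrr mul1r mul0r add0r wb.
- by have [? ?] := uivalP r; exact: w0.
- by have [? ?] := uivalP r; exact: w1.
Qed.

Lemma path_homotopic_eq (x y : X) (a b : path x y) :
  (forall s, a s = b s) -> path_homotopic a b.
Proof.
move=> ab; pose h (u : I * I) := a u.1.
have ch : continuous h.
  exact: (continuous_compT (@continuous_fstT _ _) (@cts_fun _ _ a)).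
by exists (mkcts ch); split=> r; rewrite /= /mkcts /h /= ?path_zero ?path_one.
Qed.

Lemma path_homotopic_refl (x y : X) (a : path x y) : path_homotopic a a.
Proof. exact: path_homotopic_eq. Qed.

Lemma path_homotopic_sym (x y : X) (a b : path x y) :
  path_homotopic a b -> path_homotopic b a.
Proof.
case=> H [H0 H1 Hx Hy].
pose h (u : I * I) := H (u.1, clamp (1 - uival u.2)).
have ch : continuous h.
  apply: (continuous_compT (f := fun u : I * I => (u.1, clamp (1 - uival u.2)))).
    apply: continuous_pairT; first exact: continuous_fstT.
    apply: (continuous_compT (g := clamp)); last exact: clamp_continuous.
    have ? := continuous_compT (@continuous_sndT I I) (@uival_continuous R); cont.
  exact: cts_fun.
exists (mkcts ch); split=> r; rewrite /= /mkcts /h /= ?uivalE //.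
- by rewrite clamp1 ?subr0.
- by rewrite clamp0 ?subrr.
Qed.

Lemma path_homotopic_trans (x y : X) (a b c : path x y) :
  path_homotopic a b -> path_homotopic b c -> path_homotopic a c.
Proof.
case=> H [H0 H1 Hx Hy] [K [K0 K1 Kx Ky]].
pose h (u : I * I) := if 2 * uival u.2 - 1 <= 0 then H (u.1, clamp (2 * uival u.2))
  else K (u.1, clamp (2 * uival u.2 - 1)).
have c2 := continuous_compT (@continuous_sndT I I) (@uival_continuous R).
have cH (f : I * I -> R) (L : continuousType (I * I)%type X) :
    continuous f -> continuous (fun u => L (u.1, clamp (f u))).
  move=> cf; apply: (continuous_compT (f := fun u : I * I => (u.1, clamp (f u)))).
    apply: continuous_pairT; first exact: continuous_fstT.
    exact: (continuous_compT cf clamp_continuous).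
  exact: cts_fun.
have ch : continuous h.
  apply: (paste_continuous (u := fun u : I * I => 2 * uival u.2 - 1)
    (f := fun u => H (u.1, clamp (2 * uival u.2)))
    (g := fun u => K (u.1, clamp (2 * uival u.2 - 1)))).
  - cont.
  - apply: cH; cont.
  - apply: cH; cont.
  - move=> u u0; rewrite clamp1; last by lra.
    by rewrite clamp0 ?u0 // H1 K0.
exists (mkcts ch); split=> r; rewrite /= /mkcts /h /= ?uivalE.
- by rewrite ifT ?clamp0 //; lra.
- by rewrite ifF ?clamp1 //; [lra|apply/negP; lra].
- by case: ifP.
- by case: ifP.
Qed.

Lemma path_concat_homotopic (x y z : X) (a a' : path x y) (b b' : path y z) :
  path_homotopic a a' -> path_homotopic b b' ->
  path_homotopic (path_concat a b) (path_concat a' b').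
Proof.
case=> H [H0 H1 Hx Hy] [K [K0 K1 Kx Ky]].
pose h (u : I * I) := if 2 * uival u.1 - 1 <= 0 then H (clamp (2 * uival u.1), u.2)
  else K (clamp (2 * uival u.1 - 1), u.2).
have c1 := continuous_compT (@continuous_fstT I I) (@uival_continuous R).
have cH (f : I * I -> R) (L : continuousType (I * I)%type X) :
    continuous f -> continuous (fun u => L (clamp (f u), u.2)).
  move=> cf; apply: (continuous_compT (f := fun u : I * I => (clamp (f u), u.2))).
    apply: continuous_pairT; last exact: continuous_sndT.
    exact: (continuous_compT cf clamp_continuous).
  exact: cts_fun.
have ch : continuous h.
  apply: (paste_continuous (u := fun u : I * I => 2 * uival u.1 - 1)
    (f := fun u => H (clamp (2 * uival u.1), u.2))
    (g := fun u => K (clamp (2 * uival u.1 - 1), u.2))).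
  - cont.
  - apply: cH; cont.
  - apply: cH; cont.
  - move=> u u0; rewrite clamp1; last by lra.
    by rewrite clamp0 ?u0 // Hy Kx.
exists (mkcts ch); split=> r; rewrite /= /mkcts /h /= ?uivalE.
- by rewrite path_concatE H0 K0.
- by rewrite path_concatE H1 K1.
- by rewrite ifT ?clamp0 //; lra.
- by rewrite ifF ?clamp1 //; [lra|apply/negP; lra].
Qed.

Lemma path_reverse_homotopic (x y : X) (a a' : path x y) :
  path_homotopic a a' -> path_homotopic (path_reverse a) (path_reverse a').
Proof.
case=> H [H0 H1 Hx Hy].
pose h (u : I * I) := H (clamp (1 - uival u.1), u.2).
have ch : continuous h.
  apply: (continuous_compT (f := fun u : I * I => (clamp (1 - uival u.1), u.2))).
    apply: continuous_pairT; last exact: continuous_sndT.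
    apply: (continuous_compT (g := clamp)); last exact: clamp_continuous.
    have ? := continuous_compT (@continuous_fstT I I) (@uival_continuous R); cont.
  exact: cts_fun.
exists (mkcts ch); split=> r; rewrite /= /mkcts /h /= ?uivalE.
- by rewrite H0.
- by rewrite H1.
- by rewrite clamp1 ?subr0.
- by rewrite clamp0 ?subrr.
Qed.

Lemma path_clamp_continuous (x y : X) (a : path x y) :
  continuous (fun r => a (clamp r)).
Proof. exact: (continuous_compT clamp_continuous (@cts_fun _ _ a)). Qed.

Lemma path_concatA (x y z t : X) (a : path x y) (b : path y z) (c : path z t) :
  path_homotopic (path_concat (path_concat a b) c)
                 (path_concat a (path_concat b c)).
Proof.
pose w r := if r - 1 <= 0 then a (clamp r)
            else if r - 2 <= 0 then b (clamp (r - 1)) else c (clamp (r - 2)).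
have cid : continuous (fun r : R => r) by exact: continuous_idT.
have cw : continuous w.
  apply: (paste_continuous (u := fun r : R => r - 1) (f := fun r => a (clamp r))
    (g := fun r => if r - 2 <= 0 then b (clamp (r - 1)) else c (clamp (r - 2)))).
  - cont.
  - exact: path_clamp_continuous.
  - apply: (paste_continuous (u := fun r : R => r - 2)
      (f := fun r => b (clamp (r - 1))) (g := fun r => c (clamp (r - 2)))).
    + cont.
    + apply: (continuous_compT (f := fun r : R => r - 1)
        (g := fun r => b (clamp r))); first cont.
      exact: path_clamp_continuous.
    + apply: (continuous_compT (f := fun r : R => r - 2)
        (g := fun r => c (clamp r))); first cont.
      exact: path_clamp_continuous.
    + move=> r r0; rewrite r0 clamp1; last by lra.
      by rewrite clamp0 // path_one path_zero.
  - move=> r r0; rewrite r0 clamp1; last by lra.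
    by rewrite ifT; [rewrite clamp0 // path_one path_zero | lra].
pose f (s : R) := Num.min (4 * s) (2 * s + 1).
pose g (s : R) := Num.max (2 * s) (4 * s - 1).
have cf : continuous f by rewrite /f; cont.
have cg : continuous g by rewrite /g; cont.
apply: (path_homotopic_reparam cw cf cg).
- move=> s; have [s0 s1] := uivalP s.
  rewrite !path_concatE /w /f.
  case: (leP (2 * uival s - 1) 0) => s2.
    rewrite clampK; [|lra..].
    rewrite min_l; last by lra.
    have -> : 2 * (2 * uival s) = 4 * uival s by lra.
    by case: ifP => // ?; rewrite ifT //; lra.
  rewrite min_r; last by lra.
  rewrite ifF; last by apply/negP; lra.
  rewrite ifF; last by apply/negP; lra.
  by congr (c (clamp _)); lra.
- move=> s; have [s0 s1] := uivalP s.
  rewrite !path_concatE /w /g.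
  case: (leP (2 * uival s - 1) 0) => s2.
    rewrite max_l; last by lra.
    by rewrite ifT //; lra.
  rewrite max_r; last by lra.
  rewrite clampK; [|lra..].
  rewrite (ifF (a _)); last by apply/negP; lra.
  have -> : 2 * (2 * uival s - 1) - 1 = 4 * uival s - 1 - 2 by lra.
  have -> : 2 * (2 * uival s - 1) = 4 * uival s - 1 - 1 by lra.
  by [].
- move=> r r0 r1; rewrite /f /g min_l; last by lra.
  rewrite max_l; last by lra.
  have -> : (1 - r) * (4 * 0) + r * (2 * 0) = 0 by lra.
  by rewrite /w ifT ?clamp0 ?path_zero //; lra.
- move=> r r0 r1; rewrite /f /g min_r; last by lra.
  rewrite max_r; last by lra.
  have -> : (1 - r) * (2 * 1 + 1) + r * (4 * 1 - 1) = 3 by lra.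
  rewrite /w ifF; last by apply/negP; lra.
  rewrite ifF; last by apply/negP; lra.
  by rewrite clamp1 ?path_one //; lra.
Qed.

Lemma path_concat1 (x y : X) (a : path x y) :
  path_homotopic (path_concat a (path_const y)) a.
Proof.
have cid : continuous (fun r : R => r) by exact: continuous_idT.
have cf : continuous (fun r : R => 2 * r) by cont.
apply: (path_homotopic_reparam (@path_clamp_continuous _ _ a) cf cid).
- move=> s; rewrite path_concatE ?path_constE.
  case: (leP (2 * uival s - 1) 0) => s2 //.
  by rewrite clamp1 ?path_one //; lra.
- by move=> s; rewrite uivalK.
- move=> r r0 r1; have -> : (1 - r) * (2 * 0) + r * 0 = 0 by lra.
  by rewrite clamp0 ?path_zero.
- by move=> r r0 r1; rewrite clamp1 ?path_one //; lra.
Qed.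

Lemma path_1concat (x y : X) (a : path x y) :
  path_homotopic (path_concat (path_const x) a) a.
Proof.
have cid : continuous (fun r : R => r) by exact: continuous_idT.
have cf : continuous (fun r : R => 2 * r - 1) by cont.
apply: (path_homotopic_reparam (@path_clamp_continuous _ _ a) cf cid).
- move=> s; rewrite path_concatE ?path_constE.
  case: (leP (2 * uival s - 1) 0) => s2 //.
  by rewrite clamp0 ?path_zero.
- by move=> s; rewrite uivalK.
- by move=> r r0 r1; rewrite clamp0 ?path_zero //; lra.
- by move=> r r0 r1; rewrite clamp1 ?path_one //; lra.
Qed.

Lemma path_concatV (x y : X) (a : path x y) :
  path_homotopic (path_concat a (path_reverse a)) (path_const x).
Proof.
have cid : continuous (fun r : R => r) by exact: continuous_idT.
have cf : continuous (fun r : R => Num.min (2 * r) (2 - 2 * r)) by cont.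
have cg : continuous (fun r : R => 0 : R) by cont.
apply: (path_homotopic_reparam (@path_clamp_continuous _ _ a) cf cg).
- move=> s; have [s0 s1] := uivalP s.
  rewrite path_concatE ?path_constE.
  case: (leP (2 * uival s - 1) 0) => s2.
    by rewrite min_l //; lra.
  rewrite min_r; last by lra.
  rewrite path_reverseE clampK; [|lra..].
  by congr (a (clamp _)); lra.
- by move=> s; rewrite path_constE clamp0 ?path_zero.
- by move=> r r0 r1; rewrite clamp0 ?path_zero // min_l; lra.
- by move=> r r0 r1; rewrite clamp0 ?path_zero // min_r; lra.
Qed.

Lemma path_reverseK (x y : X) (a : path x y) s :
  path_reverse (path_reverse a) s = a s.
Proof.
have [? ?] := uivalP s.
rewrite !path_reverseE.
rewrite clampK; [|lra..].
by rewrite -[in RHS](uivalK s); congr (a (clamp _)); lra.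
Qed.

Lemma path_Vconcat (x y : X) (a : path x y) :
  path_homotopic (path_concat (path_reverse a) a) (path_const y).
Proof.
apply: path_homotopic_trans (path_concatV (path_reverse a)).
apply: path_concat_homotopic; first exact: path_homotopic_refl.
by apply: path_homotopic_eq => s; rewrite path_reverseK.
Qed.

Lemma path_reverse_concat (x y z : X) (a : path x y) (b : path y z) s :
  path_reverse (path_concat a b) s = path_concat (path_reverse b) (path_reverse a) s.
Proof.
have [? ?] := uivalP s.
rewrite path_reverseE !path_concatE clampK; [|lra..].
rewrite !path_reverseE.
have [s2|s2|s2] := ltgtP (2 * uival s) 1.
- rewrite ifF; last by apply/negP; lra.
  rewrite ifT; last by lra.
  by rewrite clampK; [congr (b (clamp _)); lra|lra..].
- rewrite ifT; last by lra.
  rewrite ifF; last by apply/negP; lra.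
  by rewrite clampK; [congr (a (clamp _)); lra|lra..].
- rewrite ifT; last by lra.
  rewrite ifT; last by lra.
  rewrite clamp1 ?path_one; last by lra.
  by rewrite s2 clamp0 ?path_zero // clampK ?subrr ?lexx ?ler01.
Qed.

End Homotopy.

Section FundamentalGroup.
Context {R : realType} {X : topologicalType} (x : X).
Local Notation I := (unit_interval R).

Definition loop : Type := {path I from x to x in X}.
HB.instance Definition _ := Choice.on loop.

Definition loop_rel (a b : loop) : bool := `[< path_homotopic a b >].

Lemma loop_rel_refl : reflexive loop_rel.
Proof. by move=> a; apply/asboolP; exact: path_homotopic_refl. Qed.

Lemma loop_rel_sym : symmetric loop_rel.
Proof.
by move=> a b; apply/asboolP/asboolP => ?; exact: path_homotopic_sym.
Qed.

Lemma loop_rel_trans : transitive loop_rel.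
Proof.
move=> b a c /asboolP ab /asboolP bc.
by apply/asboolP; exact: path_homotopic_trans ab bc.
Qed.

Definition loop_equiv := EquivRel _ loop_rel_refl loop_rel_sym loop_rel_trans.

Definition pi1 : Type := {eq_quot loop_equiv}.
HB.instance Definition _ := Choice.on pi1.
HB.instance Definition _ := EqQuotient.on pi1.

Definition loop_class (a : loop) : pi1 := \pi a.

Lemma loop_classP (a b : loop) : loop_class a = loop_class b <-> path_homotopic a b.
Proof.
split=> [/eqmodP /asboolP //|ab].
by apply/eqmodP/asboolP.
Qed.

Lemma repr_loop_class (a : loop) : path_homotopic (repr (loop_class a)) a.
Proof. by apply/loop_classP; rewrite /loop_class reprK. Qed.

Lemma loop_class_repr (g : pi1) : loop_class (repr g) = g.
Proof. exact: reprK. Qed.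

Definition pi1_mul (g h : pi1) : pi1 := loop_class (path_concat (repr g) (repr h)).
Definition pi1_one : pi1 := loop_class (path_const x).
Definition pi1_inv (g : pi1) : pi1 := loop_class (path_reverse (repr g)).

Lemma pi1_mulE (a b : loop) :
  pi1_mul (loop_class a) (loop_class b) = loop_class (path_concat a b).
Proof.
by apply/loop_classP/path_concat_homotopic; exact: repr_loop_class.
Qed.

Lemma pi1_invE (a : loop) :
  pi1_inv (loop_class a) = loop_class (path_reverse a).
Proof. by apply/loop_classP/path_reverse_homotopic; exact: repr_loop_class. Qed.

Lemma pi1_mulA : associative pi1_mul.
Proof.
move=> g h k; rewrite -(loop_class_repr g) -(loop_class_repr h).
rewrite -(loop_class_repr k) !pi1_mulE.
by apply/loop_classP/path_homotopic_sym/path_concatA.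
Qed.

Lemma pi1_mul1g : left_id pi1_one pi1_mul.
Proof.
move=> g; rewrite -(loop_class_repr g) /pi1_one pi1_mulE.
exact/loop_classP/path_1concat.
Qed.

Lemma pi1_mulg1 : right_id pi1_one pi1_mul.
Proof.
move=> g; rewrite -(loop_class_repr g) /pi1_one pi1_mulE.
exact/loop_classP/path_concat1.
Qed.

Lemma pi1_mulVg : left_inverse pi1_one pi1_inv pi1_mul.
Proof.
move=> g; rewrite -(loop_class_repr g) pi1_invE pi1_mulE.
exact/loop_classP/path_Vconcat.
Qed.

Lemma pi1_mulgV : right_inverse pi1_one pi1_inv pi1_mul.
Proof.
move=> g; rewrite -(loop_class_repr g) pi1_invE pi1_mulE.
exact/loop_classP/path_concatV.
Qed.

(* In the product [a] * [b] the loop [a] is traversed first. *)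
HB.instance Definition _ := isGroup.Build pi1
  pi1_mulA pi1_mul1g pi1_mulg1 pi1_mulVg pi1_mulgV.

End FundamentalGroup.

Arguments loop R {X} x.
Arguments pi1 R {X} x.
Arguments loop_class {R X x} a.

(* The map induced on fundamental groups by f : (Y, y) -> (X, x). The
   equation f y = x is an argument, so that the images of two maps with
   propositionally equal base values are subsets of the same group. *)
Section InducedMap.
Context {R : realType} {Y X : topologicalType} (f : continuousType Y X).
Context (y : Y) (x : X) (fy : f y = x).

Section LoopMap.
Variable a : loop R y.

Lemma loop_map_continuous : continuous (f \o a).
Proof. exact: (continuous_compT (@cts_fun _ _ a) (@cts_fun _ _ f)). Qed.

Lemma loop_map_zero : (f \o a) zero = x.
Proof. by rewrite /= path_zero. Qed.

Lemma loop_map_one : (f \o a) one = x.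
Proof. by rewrite /= path_one. Qed.

Definition loop_map : loop R x :=
  mk_path loop_map_continuous loop_map_zero loop_map_one.

End LoopMap.

Definition pi1_map (g : pi1 R y) : pi1 R x := loop_class (loop_map (repr g)).

Lemma pi1_mapE (a : loop R y) :
  pi1_map (loop_class a) = loop_class (loop_map a).
Proof.
apply/loop_classP.
have [H [H0 H1 Hx Hy]] := repr_loop_class a.
pose h u := f (H u).
have ch : continuous h.
  exact: (continuous_compT (@cts_fun _ _ H) (@cts_fun _ _ f)).
exists (mkcts ch); split=> r; rewrite /= /mkcts /h.
- by rewrite H0.
- by rewrite H1.
- by rewrite Hx.
- by rewrite Hy.
Qed.

End InducedMap.

Definition disk_set (R : realType) : set (R * R) :=
  [set v | v.1 ^+ 2 + v.2 ^+ 2 <= 1].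

Definition disk (R : realType) : Type := set_type (@disk_set R).

HB.instance Definition _ (R : realType) :=
  Topological.copy (disk R) (set_type (@disk_set R)).

Section Disk.
Context {R : realType}.
Local Notation I := (unit_interval R).
Local Notation D := (disk R).

Lemma disk_base_subproof : ((1, 0) : R * R) \in @disk_set R.
Proof. by rewrite inE /disk_set /= expr1n expr0n addr0. Qed.

Definition disk_base : D := exist _ (1, 0) disk_base_subproof.

(* The square with corners (1, 0), (0, 1), (-1, 0), (0, -1) is a retract of
   the disk, which presents I * I as a retract of D with (0, 0) sent to d. *)
Lemma square_disk_subproof (u : I * I) :
  (1 - uival u.1 - uival u.2, uival u.1 - uival u.2) \in @disk_set R.
Proof.
rewrite inE /disk_set /=.
have [? ?] := uivalP u.1; have [? ?] := uivalP u.2; nra.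
Qed.

Definition square_to_disk (u : I * I) : D :=
  exist _ (1 - uival u.1 - uival u.2, uival u.1 - uival u.2)
    (square_disk_subproof u).

Definition disk_to_square (v : D) : I * I :=
  (clamp ((1 - (set_val v).1 + (set_val v).2) / 2),
   clamp ((1 - (set_val v).1 - (set_val v).2) / 2)).

Lemma square_to_diskK : cancel square_to_disk disk_to_square.
Proof.
move=> [s t]; rewrite /disk_to_square /=.
rewrite -[in RHS](uivalK s) -[in RHS](uivalK t).
by congr (clamp _, clamp _); rewrite /=; field.
Qed.

Lemma square_to_disk0 : square_to_disk (zero, zero) = disk_base.
Proof. by apply/val_inj; rewrite /= !uivalE !subr0. Qed.

Lemma square_to_disk_continuous : continuous square_to_disk.
Proof.
have ? := continuous_compT (@continuous_fstT I I) (@uival_continuous R).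
have ? := continuous_compT (@continuous_sndT I I) (@uival_continuous R).
have c : continuous (fun u : I * I =>
    (1 - uival u.1 - uival u.2, uival u.1 - uival u.2)).
  by apply: continuous_pairT; cont.
exact: (@continuous_into _ _ _ square_to_disk c).
Qed.

Lemma disk_to_square_continuous : continuous disk_to_square.
Proof.
have cv : continuous (set_val : D -> R * R) by exact: continuous_set_val.
have c1 := continuous_compT cv (@continuous_fstT R R).
have c2 := continuous_compT cv (@continuous_sndT R R).
apply: continuous_pairT.
  apply: (continuous_compT (g := clamp)); [cont|exact: clamp_continuous].
apply: (continuous_compT (g := clamp)); [cont|exact: clamp_continuous].
Qed.

Lemma disk_star_shaped (x y r : R) : 0 <= r -> r <= 1 ->
  x ^+ 2 + y ^+ 2 <= 1 -> (1 - r + r * x) ^+ 2 + (r * y) ^+ 2 <= 1.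
Proof.
move=> r0 r1 xy; have y2 := sqr_ge0 y.
have x1 : x <= 1 by rewrite leNgt; apply/negP => ?; nra.
have h1 : 0 <= r * (1 - r) * (1 - x) by rewrite !mulr_ge0 // subr_ge0.
have h2 : 0 <= r ^+ 2 * (1 - (x ^+ 2 + y ^+ 2)).
  by rewrite mulr_ge0 ?sqr_ge0 // subr_ge0.
nra.
Qed.

Lemma disk_segment_subproof (v : D) (s : I) :
  (1 - uival s + uival s * (set_val v).1, uival s * (set_val v).2)
    \in @disk_set R.
Proof.
rewrite inE; have [r0 r1] := uivalP s.
exact: disk_star_shaped r0 r1 (set_valP v).
Qed.

Definition disk_segment_fun (v : D) (s : I) : D :=
  exist _ (1 - uival s + uival s * (set_val v).1, uival s * (set_val v).2)
    (disk_segment_subproof v s).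

Lemma disk_segment_continuous (v : D) : continuous (disk_segment_fun v).
Proof.
have ? := @uival_continuous R.
have c : continuous (fun s : I =>
    (1 - uival s + uival s * (set_val v).1, uival s * (set_val v).2)).
  by apply: continuous_pairT; cont.
exact: (@continuous_into _ _ _ (disk_segment_fun v) c).
Qed.

Lemma disk_segment_zero (v : D) : disk_segment_fun v zero = disk_base.
Proof.
by apply/val_inj; rewrite /= !uivalE !mul0r subr0 addr0.
Qed.

Lemma disk_segment_one (v : D) : disk_segment_fun v one = v.
Proof.
apply/val_inj; rewrite /= !uivalE !mul1r subrr add0r.
by rewrite -surjective_pairing.
Qed.

Definition disk_segment (v : D) : {path I from disk_base to v in D} :=
  mk_path (@disk_segment_continuous v) (disk_segment_zero v) (disk_segment_one v).

End Disk.

(* The empty space is path-connected in this sense; non-emptiness is required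
   separately where it is needed. *)
Definition path_connected (R : realType) (X : topologicalType) : Prop :=
  forall x y : X, inhabited {path unit_interval R from x to y in X}.

Definition disk_covering (R : realType) (E X : topologicalType)
    (p : continuousType E X) : Prop :=
  [/\ inhabited E, path_connected R E &
      forall (e : E) (f : continuousType (disk R) X), f disk_base = p e ->
      exists! fh : continuousType (disk R) E,
        fh disk_base = e /\ p \o fh = f :> (disk R -> X)].

Section DiskLifting.
Context {R : realType} {E X : topologicalType} (p : continuousType E X).
Hypothesis pD : disk_covering R p.
Local Notation I := (unit_interval R).
Local Notation D := (disk R).

Lemma retract_lift (K : topologicalType) (k0 : K) (i : K -> D) (r : D -> K) :
  continuous i -> continuous r -> cancel i r -> i k0 = disk_base ->
  forall (e : E) (f : K -> X), continuous f -> f k0 = p e ->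
  exists l : K -> E, [/\ continuous l, l k0 = e, (forall k, p (l k) = f k) &
    forall l' : K -> E, continuous l' -> l' k0 = e ->
      (forall k, p (l' k) = f k) -> l' =1 l].
Proof.
move=> ci cr irK i0 e f cf fe.
have [_ _ pL] := pD.
pose F : continuousType D X := mkcts (continuous_compT cr cf).
have FE v : F v = f (r v) by [].
have F0 : F disk_base = p e by rewrite FE -i0 irK.
have [fh [[fh0 pfh] fhu]] := pL e F F0.
exists (fh \o i); split.
- exact: (continuous_compT ci (@cts_fun _ _ fh)).
- by rewrite /= i0.
- by move=> k; have := congr1 (fun g => g (i k)) pfh; rewrite /= FE irK.
- move=> l' cl' l'0 pl' k.
  pose G : continuousType D E := mkcts (continuous_compT cr cl').
  have GE v : G v = l' (r v) by [].
  have -> : fh = G.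
    apply: fhu; split; first by rewrite GE -i0 irK.
    by apply/funext => v; rewrite /= GE FE.
  by rewrite /= GE irK.
Qed.

Lemma square_lift (e : E) (f : I * I -> X) :
  continuous f -> f (zero, zero) = p e ->
  exists l : I * I -> E, [/\ continuous l, l (zero, zero) = e,
    (forall k, p (l k) = f k) &
    forall l' : I * I -> E, continuous l' -> l' (zero, zero) = e ->
      (forall k, p (l' k) = f k) -> l' =1 l].
Proof.
exact: (retract_lift square_to_disk_continuous disk_to_square_continuous
          square_to_diskK square_to_disk0).
Qed.

Lemma path_lift (e : E) (f : I -> X) :
  continuous f -> f zero = p e ->
  exists l : I -> E, [/\ continuous l, l zero = e, (forall k, p (l k) = f k) &
    forall l' : I -> E, continuous l' -> l' zero = e ->
      (forall k, p (l' k) = f k) -> l' =1 l].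
Proof.
pose j (s : I) : I * I := (s, zero).
have cj : continuous j.
  by apply: continuous_pairT; [exact: continuous_idT|exact: continuous_constT].
apply: (retract_lift (continuous_compT cj square_to_disk_continuous)
  (continuous_compT disk_to_square_continuous (@continuous_fstT _ _))).
- by move=> s; rewrite /comp square_to_diskK.
- exact: square_to_disk0.
Qed.

Lemma path_lift_unique (l l' : I -> E) :
  continuous l -> continuous l' -> l zero = l' zero ->
  (forall s, p (l s) = p (l' s)) -> l =1 l'.
Proof.
move=> cl cl' l0 pl.
have c := continuous_compT cl (@cts_fun _ _ p).
have [m [_ _ _ mu]] := path_lift (e := l zero) c erefl.
move=> s; rewrite (mu l) //.
by rewrite (mu l') // => k; rewrite /= pl.
Qed.

(* [lifts_to p f e e'] : some lift of the path f starting at e ends at e'. *)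
Definition lifts_to (f : I -> X) (e e' : E) : Prop :=
  exists l : {path I from e to e' in E}, forall s, p (l s) = f s.

Lemma lifts_to_mk (f : I -> X) (e e' : E) (l : I -> E) :
  continuous l -> l zero = e -> l one = e' -> (forall s, p (l s) = f s) ->
  lifts_to f e e'.
Proof. by move=> cl l0 l1 pl; exists (mk_path cl l0 l1). Qed.

Lemma lifts_to_ex (f : I -> X) (e : E) :
  continuous f -> f zero = p e -> exists e', lifts_to f e e'.
Proof.
move=> cf f0; have [l [cl l0 pl _]] := path_lift cf f0.
by exists (l one); exact: (lifts_to_mk cl).
Qed.

Lemma lifts_to_unique (f : I -> X) (e e1 e2 : E) :
  lifts_to f e e1 -> lifts_to f e e2 -> e1 = e2.
Proof.
move=> [l pl] [m pm]; rewrite -(@path_one _ _ _ _ l) -(@path_one _ _ _ _ m).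
apply: path_lift_unique; [exact: cts_fun|exact: cts_fun|..].
- by rewrite !path_zero.
- by move=> s; rewrite pl pm.
Qed.

Lemma lifts_to_eq (f g : I -> X) (e e' : E) :
  f =1 g -> lifts_to f e e' -> lifts_to g e e'.
Proof. by move=> fg [l pl]; exists l => s; rewrite pl. Qed.

Lemma lifts_to_const (e : E) (x : X) : p e = x -> lifts_to (path_const x) e e.
Proof. by move=> pe; exists (path_const e) => s; rewrite !path_constE. Qed.

Lemma lifts_to_concat (x y z : X) (a : {path I from x to y in X})
    (b : {path I from y to z in X}) (e e1 e2 : E) :
  lifts_to a e e1 -> lifts_to b e1 e2 -> lifts_to (path_concat a b) e e2.
Proof.
move=> [l pl] [m pm]; exists (path_concat l m) => s; rewrite !path_concatE.
by case: ifP.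
Qed.

Lemma lifts_to_reverse (x y : X) (a : {path I from x to y in X}) (e e' : E) :
  lifts_to a e e' -> lifts_to (path_reverse a) e' e.
Proof. by move=> [l pl]; exists (path_reverse l) => s; rewrite !path_reverseE. Qed.

Lemma lifts_to_end (f : I -> X) (e e' : E) : lifts_to f e e' -> p e' = f one.
Proof. by move=> [l pl]; rewrite -pl path_one. Qed.

Lemma lifts_to_homotopic (x y : X) (a b : {path I from x to y in X}) (e e' : E) :
  path_homotopic a b -> lifts_to a e e' -> lifts_to b e e'.
Proof.
case=> H [H0 H1 Hx Hy] [l pl].
have pe : p e = x by rewrite -(@path_zero _ _ _ _ l) pl path_zero.
have H00 : H (zero, zero) = p e by rewrite Hx.
have [L [cL L0 pL _]] := square_lift (@cts_fun _ _ H) H00.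
have cfst t : continuous (fun s => L (s, t)).
  apply: (continuous_compT (f := fun s : I => (s, t)) (g := L)) => //.
  by apply: continuous_pairT; [exact: continuous_idT|exact: continuous_constT].
have csnd s : continuous (fun t => L (s, t)).
  apply: (continuous_compT (f := fun t : I => (s, t)) (g := L)) => //.
  by apply: continuous_pairT; [exact: continuous_constT|exact: continuous_idT].
have Lx t : L (zero, t) = e.
  rewrite -[RHS]/(cst e t).
  apply: (path_lift_unique (csnd zero) (l' := cst e)) => //.
    exact: continuous_constT.
  by move=> s; rewrite pL Hx.
have L1 : L (one, zero) = e'.
  rewrite -(@path_one _ _ _ _ l).
  apply: (path_lift_unique (cfst zero) (l' := l)).
  - exact: cts_fun.
  - by rewrite L0 path_zero.
  - by move=> s; rewrite pL H0 pl.
have pe' : p e' = y by rewrite -(@path_one _ _ _ _ l) pl path_one.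
have Ly t : L (one, t) = e'.
  rewrite -[RHS]/(cst e' t).
  apply: (path_lift_unique (csnd one) (l' := cst e')) => //.
    exact: continuous_constT.
  by move=> s; rewrite pL Hy.
apply: (lifts_to_mk (cfst one)) => // s.
by rewrite pL H1.
Qed.

End DiskLifting.

Definition delta_open (R : realType) (E : topologicalType) (U : set E) : Prop :=
  forall f : continuousType (disk R) E, open (f @^-1` U).

Definition delta_generated (R : realType) (E : topologicalType) : Prop :=
  forall U : set E, open U <-> delta_open R U.

(* The set E retopologized by its Delta-open subsets. *)
Definition delta_space (R : realType) (E : topologicalType) : Type := E.

Section DeltaTopology.
Context {R : realType} {E : topologicalType}.

Lemma delta_openT : delta_open R [set: E].
Proof. by move=> f; rewrite preimage_setT; exact: openT. Qed.

Lemma delta_openI : setI_closed (@delta_open R E).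
Proof. by move=> U V oU oV f; rewrite preimage_setI; apply: openI. Qed.

Lemma delta_open_bigU (J : Type) (U : J -> set E) :
  (forall j, delta_open R (U j)) -> delta_open R (\bigcup_j U j).
Proof.
by move=> oU f; rewrite preimage_bigcup; apply: bigcup_open => j _; exact: oU.
Qed.

HB.instance Definition _ := Choice.copy (delta_space R E) E.
HB.instance Definition _ := isOpenTopological.Build (delta_space R E)
  delta_openT delta_openI delta_open_bigU.

End DeltaTopology.

Section DeltaSpace.
Context {R : realType} {E : topologicalType}.
Local Notation DE := (delta_space R E).
Local Notation D := (disk R).
Local Notation I := (unit_interval R).

Lemma open_delta_spaceE (U : set E) : (open (U : set DE)) = delta_open R U.
Proof. by []. Qed.

Lemma delta_space_continuous : continuous ((fun e : DE => e) : DE -> E).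
Proof.
apply/continuousP => U oU; rewrite open_delta_spaceE => f.
by move: U oU; apply/continuousP; exact: cts_fun.
Qed.

Lemma delta_space_disk_continuous (f : D -> E) :
  continuous f -> continuous (f : D -> DE).
Proof.
move=> cf; apply/continuousP => U; rewrite open_delta_spaceE.
exact: (fun oU => oU (mkcts cf)).
Qed.

Lemma delta_space_path_continuous (f : I -> E) :
  continuous f -> continuous (f : I -> DE).
Proof.
move=> cf; pose j (s : I) : I * I := (s, zero).
have cj : continuous j.
  by apply: continuous_pairT; [exact: continuous_idT|exact: continuous_constT].
have ci := continuous_compT cj square_to_disk_continuous.
have cr := continuous_compT disk_to_square_continuous (@continuous_fstT I I).
have c := continuous_compT ci
  (delta_space_disk_continuous (continuous_compT cr cf)).
suff -> : f = (f \o (fst \o disk_to_square)) \o (square_to_disk \o j) by [].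
by apply/funext => s; rewrite /comp square_to_diskK.
Qed.

Lemma delta_space_path_connected : path_connected R E -> path_connected R DE.
Proof.
move=> pc x y; have [a] := pc x y.
have c : continuous (a : I -> DE).
  exact: (delta_space_path_continuous (@cts_fun _ _ a)).
have a0 : (a : I -> DE) zero = x by exact: (@path_zero _ _ _ _ a).
have a1 : (a : I -> DE) one = y by exact: (@path_one _ _ _ _ a).
pose b : {path I from x to y in DE} := mk_path c a0 a1.
exact: (inhabits b).
Qed.

Lemma delta_space_delta_generated : delta_generated R DE.
Proof.
move=> U; split=> [oU f|oU].
  by move: U oU; apply/continuousP; exact: cts_fun.
rewrite open_delta_spaceE => f.
exact: (oU (mkcts (delta_space_disk_continuous (@cts_fun _ _ f)))).
Qed.

End DeltaSpace.

Lemma delta_space_map_continuous (R : realType) (E F : topologicalType)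
    (f : E -> F) :
  continuous f -> continuous (f : delta_space R E -> delta_space R F).
Proof.
move=> cf; apply/continuousP => U; rewrite !open_delta_spaceE => oU g.
exact: (oU (mkcts (continuous_compT (@cts_fun _ _ g) cf))).
Qed.

Definition delta_map (R : realType) (E F : topologicalType)
    (f : continuousType E F) :
    continuousType (delta_space R E) (delta_space R F) :=
  mkcts (delta_space_map_continuous (R := R) (@cts_fun _ _ f)).

Definition delta_covering (R : realType) (Xt X : topologicalType)
    (p : continuousType Xt X) : Prop :=
  [/\ path_connected R Xt, delta_generated R Xt &
      forall Y : topologicalType, path_connected R Y -> delta_generated R Y ->
      forall (xt : Xt) (y : Y) (f : continuousType Y X) (fy : f y = p xt),
      range (pi1_map (R := R) fy) `<=` range (pi1_map (R := R) (erefl (p xt))) ->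
      exists! ft : continuousType Y Xt, ft y = xt /\ p \o ft = f :> (Y -> X)].

Section DeltaCovering.
Context {R : realType} {E X : topologicalType} (p : continuousType E X).
Hypothesis pD : disk_covering R p.
Local Notation I := (unit_interval R).
Local Notation D := (disk R).
Local Notation DE := (delta_space R E).

Definition delta_proj : continuousType DE X :=
  mkcts (continuous_compT (@delta_space_continuous R E) (@cts_fun _ _ p)).

Lemma delta_projE (e : E) : delta_proj e = p e.
Proof. by []. Qed.

Lemma delta_proj_disk_covering : disk_covering R delta_proj.
Proof.
have [neE pcE pL] := pD.
split=> //; first exact: delta_space_path_connected.
move=> e f fe; have [fh [[fh0 pfh] fhu]] := pL e f fe.
pose F : continuousType D DE :=
  mkcts (delta_space_disk_continuous (@cts_fun _ _ fh)).
exists F; split=> // G [G0 pG].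
pose G' : continuousType D E :=
  mkcts (continuous_compT (@cts_fun _ _ G) delta_space_continuous).
have fhG : fh = G' by exact: fhu.
by apply/continuousEP => v; rewrite -[RHS]/(G' v) -fhG.
Qed.

(* The lifting property of p : Delta(E) -> X : the lift of f sends z to the
   end of the lift, starting at e, of the image of any path from y to z. *)
Section Lift.
Context (Y : topologicalType) (pcY : path_connected R Y).
Context (gY : delta_generated R Y) (e : E) (y : Y).
Context (f : continuousType Y X) (fy : f y = p e).
Hypothesis fp : range (pi1_map (R := R) fy) `<=`
  range (pi1_map (R := R) (f := delta_proj) (y := e) (erefl (p e))).

Let path_cts (a b : Y) (g : {path I from a to b in Y}) : continuous (f \o g).
Proof. exact: (continuous_compT (@cts_fun _ _ g) (@cts_fun _ _ f)). Qed.

Let fpath (a b : Y) (g : {path I from a to b in Y}) :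
  {path I from f a to f b in X} := f \o g.

Let loop_lifts (g : loop R y) : lifts_to p (f \o g) e e.
Proof.
have [h _] : range (pi1_map (R := R) (f := delta_proj) (y := e) (erefl (p e)))
    (loop_class (loop_map fy g)).
  by apply: fp; exists (loop_class g) => //; exact: pi1_mapE.
rewrite -(loop_class_repr h) pi1_mapE => /loop_classP hg.
have : lifts_to p (loop_map fy g) e e.
  apply: (lifts_to_homotopic pD hg).
  apply: (lifts_to_mk (l := repr h : I -> E)).
  - exact: (continuous_compT (@cts_fun _ _ (repr h)) delta_space_continuous).
  - exact: (@path_zero _ _ _ _ (repr h)).
  - exact: (@path_one _ _ _ _ (repr h)).
  - by [].
exact: lifts_to_eq.
Qed.

Definition delta_lift_rel (z : Y) (e' : E) : Prop :=
  exists g : {path I from y to z in Y}, lifts_to p (f \o g) e e'.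

Lemma delta_lift_rel_ex z : exists e', delta_lift_rel z e'.
Proof.
have [g] := pcY y z.
have g0 : (f \o g) zero = p e by rewrite /= path_zero.
have [e' ge'] := lifts_to_ex pD (@path_cts _ _ g) g0.
by exists e'; exists g.
Qed.

Lemma delta_lift_rel_unique z e1 e2 :
  delta_lift_rel z e1 -> delta_lift_rel z e2 -> e1 = e2.
Proof.
move=> [g1 l1] [g2 l2].
have l1' : lifts_to p (fpath g1) e e1 by [].
have l2' : lifts_to p (fpath g2) e e2 by [].
have cr := @cts_fun _ _ (path_reverse (fpath g2)).
have r0 : path_reverse (fpath g2) zero = p e1.
  by rewrite path_zero (lifts_to_end l1) /= path_one.
have [e3 l3] := lifts_to_ex pD cr r0.
have l4 := lifts_to_concat l1' l3.
have l5 := loop_lifts (path_concat g1 (path_reverse g2)).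
have e3E : e3 = e.
  apply: (lifts_to_unique pD l4); apply: lifts_to_eq l5 => s.
  by rewrite /= !path_concatE; case: ifP.
rewrite e3E in l3; have l6 := lifts_to_reverse l3.
apply: (lifts_to_unique pD _ l2'); apply: lifts_to_eq l6 => s.
exact: path_reverseK.
Qed.

Definition delta_lift (z : Y) : DE := projT1 (cid (delta_lift_rel_ex z)).

Lemma delta_liftP z : delta_lift_rel z (delta_lift z).
Proof. exact: (projT2 (cid (delta_lift_rel_ex z))). Qed.

Lemma delta_lift_base : delta_lift y = e.
Proof.
apply: (delta_lift_rel_unique (delta_liftP y)).
exists (path_const y); apply: lifts_to_eq (lifts_to_const (erefl (p e))) => s.
by rewrite /= !path_constE fy.
Qed.

Lemma delta_lift_proj z : p (delta_lift z) = f z.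
Proof.
by have [g /lifts_to_end ->] := delta_liftP z; rewrite /= path_one.
Qed.

Lemma delta_lift_continuous : continuous delta_lift.
Proof.
apply/continuousP => U oU; apply/gY => u.
have [_ _ pL] := pD.
pose v : continuousType D X := mkcts (continuous_compT (@cts_fun _ _ u) (@cts_fun _ _ f)).
have vE z : v z = f (u z) by [].
have v0 : v disk_base = p (delta_lift (u disk_base)).
  by rewrite delta_lift_proj.
have [k [[k0 pk] _]] := pL _ v v0.
suff kE : delta_lift \o u = k.
  rewrite -comp_preimage kE; move: U oU; apply/continuousP.
  exact: (delta_space_disk_continuous (@cts_fun _ _ k)).
apply/funext => z /=.
have [g lg] := delta_liftP (u disk_base).
apply: (delta_lift_rel_unique (delta_liftP (u z))).
have cs := continuous_compT (@cts_fun _ _ (disk_segment z)) (@cts_fun _ _ u).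
have s0 : (u \o disk_segment z) zero = u disk_base by rewrite /= path_zero.
have s1 : (u \o disk_segment z) one = u z by rewrite /= path_one.
pose h : {path I from u disk_base to u z in Y} := mk_path cs s0 s1.
exists (path_concat g h).
have lg' : lifts_to p (fpath g) e (delta_lift (u disk_base)) by [].
have lh : lifts_to p (fpath h) (delta_lift (u disk_base)) (k z).
  apply: (lifts_to_mk (l := k \o disk_segment z)).
  - exact: (continuous_compT (@cts_fun _ _ (disk_segment z)) (@cts_fun _ _ k)).
  - by rewrite /= path_zero.
  - by rewrite /= path_one.
  - by move=> s; have := congr1 (fun w => w (disk_segment z s)) pk.
apply: lifts_to_eq (lifts_to_concat lg' lh) => s.
by rewrite /= !path_concatE; case: ifP.
Qed.

End Lift.

Lemma delta_proj_delta_covering : delta_covering R delta_proj.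
Proof.
have [neE pcE pL] := pD.
split; [exact: delta_space_path_connected|exact: delta_space_delta_generated|].
move=> Y pcY gY e y f fy fp.
have c : continuous (delta_lift pcY fy) by exact: delta_lift_continuous.
pose F : continuousType Y DE := mkcts c.
exists F; split.
  split; first exact: delta_lift_base.
  by apply/funext => z; exact: delta_lift_proj.
move=> G [G0 pG]; apply/continuousEP => z.
apply: (delta_lift_rel_unique fp (delta_liftP pcY fy z)).
have [g] := pcY y z; exists g.
apply: (lifts_to_mk (l := G \o g : I -> E)).
- apply: (continuous_compT _ (@delta_space_continuous R E)).
  exact: (continuous_compT (@cts_fun _ _ g) (@cts_fun _ _ G)).
- by rewrite /= path_zero.
- by rewrite /= path_one.
- by move=> s; have := congr1 (fun w => w (g s)) pG.
Qed.

End DeltaCovering.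

Record category := Category {
  cat_ob :> Type;
  cat_hom : cat_ob -> cat_ob -> Type;
  cat_id : forall A, cat_hom A A;
  cat_comp : forall A B C, cat_hom B C -> cat_hom A B -> cat_hom A C;
  cat_comp_idl : forall A B (f : cat_hom A B), cat_comp (cat_id B) f = f;
  cat_comp_idr : forall A B (f : cat_hom A B), cat_comp f (cat_id A) = f;
  cat_compA : forall A B C D (h : cat_hom C D) (g : cat_hom B C) (f : cat_hom A B),
    cat_comp h (cat_comp g f) = cat_comp (cat_comp h g) f
}.

Record functor (C D : category) := Functor {
  fob :> C -> D;
  fmap : forall A B, cat_hom A B -> cat_hom (fob A) (fob B);
  fmap_id : forall A, fmap (cat_id A) = cat_id (fob A);
  fmap_comp : forall A B E (g : cat_hom B E) (f : cat_hom A B),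
    fmap (cat_comp g f) = cat_comp (fmap g) (fmap f)
}.

Definition functor_comp (C D E : category) (G : functor D E) (F : functor C D) :
  functor C E.
Proof.
exists (fun A => G (F A)) (fun A B f => fmap G (fmap F f)).
- by move=> A; rewrite !fmap_id.
- by move=> A B K g f; rewrite !fmap_comp.
Defined.

Definition isomorphism (C : category) (A B : C) (f : cat_hom A B) : Prop :=
  exists g : cat_hom B A, cat_comp g f = cat_id A /\ cat_comp f g = cat_id B.

Record nat_trans (C D : category) (F G : functor C D) := NatTrans {
  nt_map :> forall A, cat_hom (F A) (G A);
  nt_natural : forall A B (f : cat_hom A B),
    cat_comp (nt_map B) (fmap F f) = cat_comp (fmap G f) (nt_map A)
}.

Definition naturally_isomorphic (C D : category) (F G : functor C D) : Prop :=
  exists eta : nat_trans F G, forall A, isomorphism (eta A).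

Definition fully_faithful (C D : category) (F : functor C D) : Prop :=
  forall A B : C, bijective (@fmap C D F A B).

Definition full_subcategory (C : category) (P : C -> Prop) : category.
Proof.
exists {A : C | P A} (fun A B => cat_hom (sval A) (sval B)) (fun A => cat_id (sval A))
  (fun A B K g f => cat_comp g f).
- by move=> A B f; exact: cat_comp_idl.
- by move=> A B f; exact: cat_comp_idr.
- by move=> A B K L h g f; exact: cat_compA.
Defined.

Definition full_inclusion (C : category) (P : C -> Prop) :
  functor (full_subcategory P) C.
Proof. by exists (fun A => sval A) (fun A B f => f). Defined.

Record gset (G : groupType) := GSetOb {
  gs_carrier :> Type;
  gs_act : G -> gs_carrier -> gs_carrier;
  gs_act1 : forall e, gs_act 1%g e = e;
  gs_actM : forall g h e, gs_act (g * h)%g e = gs_act g (gs_act h e)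
}.

Record gset_hom (G : groupType) (S T : gset G) := GSetHom {
  gh_fun :> S -> T;
  gh_equivariant : forall g e, gh_fun (gs_act g e) = gs_act g (gh_fun e)
}.

Lemma gset_hom_eq (G : groupType) (S T : gset G) (f g : gset_hom S T) :
  f =1 g -> f = g.
Proof.
case: f g => [f fE] [g gE] /= /funext fg; rewrite fg in fE *.
by rewrite (Prop_irrelevance fE gE).
Qed.

Definition gset_id (G : groupType) (S : gset G) : gset_hom S S :=
  @GSetHom G S S id (fun _ _ => erefl).

Definition gset_comp (G : groupType) (S T U : gset G)
    (g : gset_hom T U) (f : gset_hom S T) : gset_hom S U.
Proof.
by exists (g \o f) => a e; rewrite /= !gh_equivariant.
Defined.

Definition GSet (G : groupType) : category.
Proof.
exists (gset G) (@gset_hom G) (@gset_id G) (@gset_comp G).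
- by move=> S T f; exact: gset_hom_eq.
- by move=> S T f; exact: gset_hom_eq.
- by move=> S T U V h g f; exact: gset_hom_eq.
Defined.

Section DCov.
Context (R : realType) (X : topologicalType).

Record dcov := DCovOb {
  dc_total : topologicalType;
  dc_proj :> continuousType dc_total X;
  dc_cov : disk_covering R dc_proj
}.

Record dcov_hom (p q : dcov) := DCovHom {
  dh_fun :> continuousType (dc_total p) (dc_total q);
  dh_comm : q \o dh_fun = p :> (dc_total p -> X)
}.

Lemma dcov_hom_eq (p q : dcov) (f g : dcov_hom p q) : f =1 g -> f = g.
Proof.
case: f g => [f fE] [g gE] /= fg.
have {}fg : f = g by exact/continuousEP.
by rewrite fg in fE *; rewrite (Prop_irrelevance fE gE).
Qed.

Definition dcov_id (p : dcov) : dcov_hom p p := @DCovHom p p idfun erefl.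

Definition dcov_comp (p q r : dcov) (g : dcov_hom q r) (f : dcov_hom p q) :
  dcov_hom p r.
Proof.
exists (mkcts (continuous_compT (@cts_fun _ _ f) (@cts_fun _ _ g))).
by rewrite -(dh_comm f) -(dh_comm g).
Defined.

Definition DCov : category.
Proof.
exists dcov dcov_hom dcov_id dcov_comp.
- by move=> p q f; exact: dcov_hom_eq.
- by move=> p q f; exact: dcov_hom_eq.
- by move=> p q r s h g f; exact: dcov_hom_eq.
Defined.

(* Objects are the disk-coverings that are Delta-coverings. *)
Definition DeltaCov : category :=
  full_subcategory (C := DCov) (fun p : dcov => delta_covering R p).

Definition delta_dcov (p : dcov) : dcov :=
  DCovOb (delta_proj_disk_covering (dc_cov p)).

Definition delta_ob (p : dcov) : DeltaCov :=
  exist _ (delta_dcov p) (delta_proj_delta_covering (dc_cov p)).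

Definition delta_hom (p q : dcov) (f : dcov_hom p q) :
  dcov_hom (delta_dcov p) (delta_dcov q).
Proof.
apply: (@DCovHom (delta_dcov p) (delta_dcov q) (delta_map R f)).
by apply/funext => e; exact: (congr1 (fun h => h e) (dh_comm f)).
Defined.

Definition Delta : functor DCov DeltaCov.
Proof.
exists (delta_ob : DCov -> DeltaCov) delta_hom.
- by move=> p; exact: dcov_hom_eq.
- by move=> p q r g f; exact: dcov_hom_eq.
Defined.

End DCov.

Section Monodromy.
Context (R : realType) (X : topologicalType) (x0 : X).
Local Notation I := (unit_interval R).
Local Notation G := (pi1 R x0).

Definition fiber (p : dcov R X) : Type := {e : dc_total p | p e = x0}.

Lemma fiber_eq (p : dcov R X) (d e : fiber p) : sval d = sval e -> d = e.
Proof. by case: d e => [d dE] [e eE] /= de; exact: eq_exist. Qed.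

Section Action.
Variable p : dcov R X.

Lemma monodromy_ex (g : G) (e : fiber p) :
  exists e' : fiber p, lifts_to p (path_reverse (repr g)) (sval e) (sval e').
Proof.
have r0 : path_reverse (repr g) zero = p (sval e).
  by rewrite path_zero (svalP e).
have [e' le'] := lifts_to_ex (dc_cov p) (@cts_fun _ _ (path_reverse (repr g))) r0.
have pe' : p e' = x0.
  rewrite (lifts_to_end le').
  exact: (@path_one _ _ _ _ (path_reverse (repr g))).
by exists (exist _ e' pe').
Qed.

(* The left action: g . e is the end of the lift, starting at e, of the
   REVERSE of a loop representing g; it does not depend on the representative
   by [monodromyP] and [monodromy_eq]. *)
Definition monodromy (g : G) (e : fiber p) : fiber p :=
  projT1 (cid (monodromy_ex g e)).

Lemma monodromyP (a : loop R x0) (e : fiber p) :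
  lifts_to p (path_reverse a) (sval e) (sval (monodromy (loop_class a) e)).
Proof.
apply: (lifts_to_homotopic (dc_cov p) _ (projT2 (cid (monodromy_ex _ e)))).
exact/path_reverse_homotopic/repr_loop_class.
Qed.

Lemma monodromy_eq (a : loop R x0) (e e' : fiber p) :
  lifts_to p (path_reverse a) (sval e) (sval e') -> monodromy (loop_class a) e = e'.
Proof.
move=> le'; apply: fiber_eq.
exact: (lifts_to_unique (dc_cov p) (monodromyP a e) le').
Qed.

Lemma monodromy1 (e : fiber p) : monodromy 1%g e = e.
Proof.
apply: (@monodromy_eq (path_const x0)).
by apply: lifts_to_eq (lifts_to_const (svalP e)) => s.
Qed.

Lemma monodromyM (g h : G) (e : fiber p) :
  monodromy (g * h)%g e = monodromy g (monodromy h e).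
Proof.
rewrite -(loop_class_repr g) -(loop_class_repr h).
have -> : (loop_class (repr g) * loop_class (repr h))%g
    = loop_class (path_concat (repr g) (repr h)) by exact: pi1_mulE.
apply: monodromy_eq.
apply: lifts_to_eq (lifts_to_concat (monodromyP (repr h) e) (monodromyP (repr g) _)).
by move=> s; rewrite path_reverse_concat.
Qed.

Definition monodromy_gset : gset G := GSetOb monodromy1 monodromyM.

End Action.

Section Restriction.
Context (p q : dcov R X) (f : dcov_hom p q).

Lemma fiber_map_subproof (e : fiber p) : q (f (sval e)) = x0.
Proof.
by have := congr1 (fun h => h (sval e)) (dh_comm f) => /= ->; exact: (svalP e).
Qed.

Definition fiber_map (e : fiber p) : fiber q :=
  exist _ (f (sval e)) (fiber_map_subproof e).

Lemma fiber_map_equivariant (g : G) (e : fiber p) :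
  fiber_map (monodromy g e) = monodromy g (fiber_map e).
Proof.
rewrite -(loop_class_repr g).
have [l pl] := monodromyP (repr g) e.
apply: esym; apply: (@monodromy_eq q (repr g) (fiber_map e)).
apply: (lifts_to_mk (l := f \o l)).
- exact: (continuous_compT (@cts_fun _ _ l) (@cts_fun _ _ f)).
- by rewrite /= path_zero.
- by rewrite /= path_one.
- by move=> s; rewrite -pl; exact: (congr1 (fun h => h (l s)) (dh_comm f)).
Qed.

Definition monodromy_hom : gset_hom (monodromy_gset p) (monodromy_gset q) :=
  @GSetHom _ (monodromy_gset p) (monodromy_gset q)
    fiber_map fiber_map_equivariant.

End Restriction.

Definition mu_DCov : functor (DCov R X) (GSet G).
Proof.
exists (monodromy_gset : DCov R X -> GSet G) monodromy_hom.
- by move=> p; apply: gset_hom_eq => e; exact: fiber_eq.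
- by move=> p q r g f; apply: gset_hom_eq => e; exact: fiber_eq.
Defined.

Definition mu_DeltaCov : functor (DeltaCov R X) (GSet G) :=
  functor_comp mu_DCov (full_inclusion _).

End Monodromy.

(* Main.v *)
(* Full faithfulness: the total space of a covering is path-connected, so its
   fibre over x0 is a transitive G-set and a morphism of coverings is determined
   by its value at one point of the fibre.  Conversely, an equivariant map phi
   sending e to e' maps the stabilizer of e into that of e', i.e. the image of
   pi1(E, e) in G into the image of pi1(E', e'); the lifting property of a
   Delta-covering then extends e |-> e' to a morphism, which restricts to phi by
   transitivity.  The natural isomorphism is the restriction to fibres of the
   identity maps Delta(E) -> E, which are morphisms of coverings. *)
Require Import Defs.
From mathcomp Require Import all_boot all_algebra all_classical reals topology.
From mathcomp Require Import homotopy.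

Lemma inj_surj_bijective (A B : Type) (f : A -> B) :
  injective f -> (forall b, exists a, f a = b) -> bijective f.
Proof.
move=> f_inj /choice[g fgK].
by exists g => // a; apply: f_inj; rewrite fgK.
Qed.

(** The inverse function is automatically equivariant. *)
Lemma gset_hom_bijective_iso (G : groupType) (S T : GSet G) (f : cat_hom S T) :
  bijective (gh_fun f) -> isomorphism f.
Proof.
move=> [g fK gK].
have gE (a : G) (t : gs_carrier T) : g (gs_act a t) = gs_act a (g t).
  by rewrite -{1}(gK t) -gh_equivariant fK.
by exists (@GSetHom G T S g gE); split; apply: gset_hom_eq.
Qed.

Section Fibers.
Local Open Scope classical_set_scope.
Context (R : realType) (X : topologicalType) (x0 : X).
Local Notation I := (unit_interval R).
Implicit Types p q : dcov R X.

(** Any path in [X] from a point of the image to [x0] lifts, and the lift ends in the fiber. *)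
Lemma fiber_inhabited p : path_connected R X -> inhabited (fiber x0 p).
Proof.
move=> hX; have [[e] _ _] := dc_cov p; have [a] := hX (p e) x0.
have [e' le'] := lifts_to_ex (dc_cov p) (@cts_fun _ _ a) (@path_zero _ _ _ _ a).
have pe' : p e' = x0 by rewrite (lifts_to_end le'); exact: (@path_one _ _ _ _ a).
exact: (inhabits (exist _ e' pe')).
Qed.

(** The action lifts reversed loops, so acting by the class of the reverse of [a] amounts to lifting
    [a] itself: the two reversals cancel. *)
Lemma monodromy_proj p (d e : fiber x0 p)
    (l : {path I from sval d to sval e in dc_total p}) (a : loop R x0) :
  (forall s, p (l s) = a s) -> monodromy (loop_class (path_reverse a)) d = e.
Proof.
move=> la; apply: monodromy_eq; exists l => s.
by rewrite path_reverseK la.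
Qed.

Lemma monodromy_transitive p (d e : fiber x0 p) :
  exists g : pi1 R x0, monodromy g d = e.
Proof.
have [_ pcE _] := dc_cov p; have [l] := pcE (sval d) (sval e).
have ca := continuous_compT (@cts_fun _ _ l) (@cts_fun _ _ p).
have a0 : (p \o l) zero = x0 by rewrite /= path_zero (svalP d).
have a1 : (p \o l) one = x0 by rewrite /= path_one (svalP e).
pose a : loop R x0 := mk_path ca a0 a1.
by exists (loop_class (path_reverse a)); exact: (monodromy_proj _ _ _ l).
Qed.

(** Turns membership in the stabilizer of [e] into a loop at [e] in the total space. *)
Lemma monodromy_fixed_lifts q (e : fiber x0 q) (a : loop R x0) :
  monodromy (loop_class a) e = e -> lifts_to q a (sval e) (sval e).
Proof.
move=> ae; have := monodromyP a e; rewrite ae => /lifts_to_reverse.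
by apply: lifts_to_eq => s; exact: path_reverseK.
Qed.

Lemma monodromy_hom_eq p q (f g : gset_hom (monodromy_gset x0 p) (monodromy_gset x0 q))
    (e : fiber x0 p) : f e = g e -> f = g.
Proof.
move=> fge; apply: gset_hom_eq => d.
have [a <-] := monodromy_transitive p e d.
by rewrite -[monodromy a e]/(@gs_act _ (monodromy_gset x0 p) a e) !gh_equivariant fge.
Qed.

(** Along a path from [e] to [d], both morphisms give lifts through [q] of the same path in [X] with
    the same start, so unique path lifting makes their ends agree. *)
Lemma dcov_hom_eq_at p q (f g : dcov_hom p q) (e : dc_total p) : f e = g e -> f = g.
Proof.
move=> fge; apply: dcov_hom_eq => d.
have [_ pcE _] := dc_cov p; have [l] := pcE e d.
rewrite -(@path_one _ _ _ _ l).
apply: (path_lift_unique (dc_cov q) (l := f \o l) (l' := g \o l)).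
- exact: (continuous_compT (@cts_fun _ _ l) (@cts_fun _ _ f)).
- exact: (continuous_compT (@cts_fun _ _ l) (@cts_fun _ _ g)).
- by rewrite /= path_zero.
- move=> s; have /(congr1 (fun h => h (l s))) /= -> := dh_comm f.
  by have /(congr1 (fun h => h (l s))) /= -> := dh_comm g.
Qed.

Lemma monodromy_hom_surjective p q (e : fiber x0 p)
    (phi : gset_hom (monodromy_gset x0 p) (monodromy_gset x0 q)) :
  delta_generated R (dc_total p) -> delta_covering R q ->
  exists f : dcov_hom p q, monodromy_hom x0 f = phi.
Proof.
move=> gE [_ _ qL]; have [_ pcE _] := dc_cov p.
have pq : p (sval e) = q (sval (phi e)) by rewrite (svalP e) (svalP (phi e)).
have sub : range (pi1_map (R := R) pq) `<=`
    range (pi1_map (R := R) (erefl (q (sval (phi e))))).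
  move=> _ [g _ <-]; rewrite -(loop_class_repr g); set a := repr g.
  pose b : loop R x0 := loop_map (svalP e) a.
  (* The loop [b] lifts to [a] at [e], so the class of its reverse fixes [e], hence also [phi e] by
     equivariance. *)
  have [l ql] : lifts_to q (path_reverse b) (sval (phi e)) (sval (phi e)).
    apply: monodromy_fixed_lifts.
    apply: etrans (esym (gh_equivariant phi (loop_class (path_reverse b)) e)) _.
    by congr (phi _); exact: (monodromy_proj _ _ _ a).
  (* Since [l] lies over the reverse of [b], its own reverse lies over [b], that is, over the image
     of [a]. *)
  exists (loop_class (path_reverse l)) => //; rewrite !pi1_mapE.
  apply/loop_classP/path_homotopic_eq => s.
  by rewrite -[RHS](path_reverseK b) path_reverseE -ql.
(* The map being lifted through [q] is [p] itself. *)
have [f [[fe fp] _]] := qL _ pcE gE _ _ _ pq sub.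
exists (@DCovHom _ _ p q f fp).
by apply: (monodromy_hom_eq _ _ _ _ e); exact: fiber_eq.
Qed.

Lemma mu_DeltaCov_fully_faithful :
  path_connected R X -> fully_faithful (mu_DeltaCov R x0).
Proof.
move=> hX [p pD] [q qD]; have [e] := fiber_inhabited p hX.
apply: inj_surj_bijective => [f g fg|phi].
  apply: (dcov_hom_eq_at p q f g (sval e)).
  exact: (congr1 (fun h : gset_hom (monodromy_gset x0 p) (monodromy_gset x0 q) =>
    sval (h e)) fg).
by have [_ gE _] := pD; exact: monodromy_hom_surjective.
Qed.

(** Continuous because every open set is Delta-open; the inverse function need not be continuous,
    but it is still a bijection on fibers. *)
Definition delta_counit p : dcov_hom (delta_dcov p) p :=
  @DCovHom R X (delta_dcov p) p (mkcts (@delta_space_continuous R (dc_total p))) erefl.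

Lemma delta_counit_natural p q (f : dcov_hom p q) :
  dcov_comp (delta_counit q) (delta_hom f) = dcov_comp f (delta_counit p).
Proof. exact: dcov_hom_eq. Qed.

Lemma delta_counit_fiber_bijective p : bijective (@fiber_map _ _ x0 _ _ (delta_counit p)).
Proof.
by exists (fun e : fiber x0 p => exist _ (sval e) (svalP e) : fiber x0 (delta_dcov p)) => e;
  exact: fiber_eq.
Qed.

Lemma mu_Delta_naturally_isomorphic :
  naturally_isomorphic (functor_comp (mu_DeltaCov R x0) (Delta R X)) (mu_DCov R x0).
Proof.
have nat p q (f : cat_hom (p : DCov R X) q) :
    cat_comp (monodromy_hom x0 (delta_counit q) : cat_hom (c := GSet _) _ _)
      (Defs.fmap (functor_comp (mu_DeltaCov R x0) (Delta R X)) f)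
    = cat_comp (Defs.fmap (mu_DCov R x0) f)
        (monodromy_hom x0 (delta_counit p) : cat_hom (c := GSet _) _ _).
  (* Apply [mu_DCov] to the naturality square in [DCov]; [mu_DeltaCov] is the same functor on the
     subcategory, so this is the required square. *)
  have := congr1 (Defs.fmap (mu_DCov R x0) (A := delta_dcov p) (B := q))
    (delta_counit_natural p q f).
  rewrite -[dcov_comp _ (delta_hom f)]/(cat_comp (c := DCov R X) _ _).
  rewrite -[dcov_comp f _]/(cat_comp (c := DCov R X) _ _).
  by rewrite !Defs.fmap_comp.
exists (@NatTrans _ _ (functor_comp (mu_DeltaCov R x0) (Delta R X)) (mu_DCov R x0) _ nat).
move=> p; apply: gset_hom_bijective_iso; exact: delta_counit_fiber_bijective.
Qed.

End Fibers.

Theorem theorem45 (R : realType) (X : topologicalType) (x0 : X)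
    (hX : path_connected R X) :
  fully_faithful (mu_DeltaCov R x0) /\
  naturally_isomorphic (functor_comp (mu_DeltaCov R x0) (Delta R X))
    (mu_DCov R x0).
Proof.
split; first exact: mu_DeltaCov_fully_faithful.
exact: mu_Delta_naturally_isomorphic.
Qed.
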